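(* Let $\mathbb F\in\{\mathbb Q,\mathbb R,\mathbb C\}$. Then $\mathrm{VNPC}(\le_{\mathsf p})\subseteq\mathrm{VNPC}(\le_{\mathsf c})\subseteq\mathrm{VNPC}(\trianglelefteq_{\mathsf c})$ and $\mathrm{VNPC}(\le_{\mathsf p})\subseteq\mathrm{VNPC}(\trianglelefteq_{\mathsf p})\subseteq\mathrm{VNPC}(\trianglelefteq_{\mathsf c})$; moreover $\mathrm{VNPC}(\le_{\mathsf c})\not\subseteq\mathrm{VNPC}(\le_{\mathsf p})$, $\mathrm{VNPC}(\trianglelefteq_{\mathsf p})\not\subseteq\mathrm{VNPC}(\le_{\mathsf p})$, $\mathrm{VNPC}(\le_{\mathsf c})\not\subseteq\mathrm{VNPC}(\trianglelefteq_{\mathsf p})$, and $\mathrm{VNPC}(\trianglelefteq_{\mathsf c})\not\subseteq\mathrm{VNPC}(\trianglelefteq_{\mathsf p})$.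
   Context: $\varepsilon$ is a new indeterminate. A $\mathsf p$-family $(f)=(f_n)_{n\in\mathbb N}$ is a sequence of multivariate polynomials whose number of variables and degree are polynomially bounded in $n$. Projection: $f\in K[x_1,\dots,x_N]$ is a projection of $g\in K[y_1,\dots,y_M]$ ($f\le g$) if $f=g(\alpha_1,\dots,\alpha_M)$ with each $\alpha_i\in\{x_1,\dots,x_N\}\cup K$. $(f)\le_{\mathsf p}(g)$ if there is a polynomially bounded $t$ with $f_n\le g_{t(n)}$ for all $n$. The oracle complexity $L^g(f)$ is the minimum size of a circuit with $+$, $\times$ and $g$-oracle gates (outputting $g$ evaluated at its inputs; leaves labelled by variables or constants) computing $f$; $(f)\le_{\mathsf c}(g)$ if $L^{g_{t(n)}}(f_n)$ is polynomially bounded for some polynomially bounded $t$. For $f,g$ over $\mathbb F$, $f\trianglelefteq g$ if $f+\varepsilon h\le g$ (projection over the field $\mathbb F(\varepsilon)$) for some polynomial $h$ over $\mathbb F[\varepsilon]$; $(f)\trianglelefteq_{\mathsf p}(g)$ if $f_n\trianglelefteq g_{t(n)}$ for all $n$ for a polynomially bounded $t$. $\overline{L^g}(f)$ is the least $c$ such that $L^g_{\mathbb F(\varepsilon)}(f+\varepsilon h)\le c$ for some polynomial $h$ over $\mathbb F[\varepsilon]$, where $L^g_{\mathbb F(\varepsilon)}$ is oracle complexity over $\mathbb F(\varepsilon)$; $(f)\trianglelefteq_{\mathsf c}(g)$ if $\overline{L^{g_{t(n)}}}(f_n)$ is polynomially bounded for some polynomially bounded $t$. $\mathrm{HC}_n=\sum_{\pi}\prod_{i=1}^n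 x_{i,\pi(i)}$, summing over permutations $\pi$ of $\{1,\dots,n\}$ that are $n$-cycles. $\mathrm{VNP}$ is the set of $\mathsf p$-families $(f)$ over $\mathbb F$ with $(f)\le_{\mathsf p}(\mathrm{HC})$. For a reduction $\le$, $\mathrm{VNPC}(\le)=\{(f)\in\mathrm{VNP}:(\mathrm{HC})\le(f)\}$. *)

(* Defs.v *)
From HB Require Import structures.
From mathcomp Require Import all_boot all_order all_algebra all_fingroup.
From mathcomp Require Import Rstruct complex mpoly.

Set Implicit Arguments.
Unset Strict Implicit.
Unset Printing Implicit Defensive.

Import GRing.Theory.
Local Open Scope ring_scope.

Definition polybounded (t : nat -> nat) : Prop :=
  exists c : nat, forall n : nat, (t n <= c * n ^ c + c)%N.

(* Total degree of a multivariate polynomial (msize p = 1 + degree,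
   msize 0 = 0). *)
Definition mdegree (K : comNzRingType) (N : nat) (p : {mpoly K[N]}) : nat :=
  (msize p).-1.

Definition is_proj (K : comNzRingType) (N M : nat)
    (f : {mpoly K[N]}) (g : {mpoly K[M]}) : Prop :=
  exists lq : M.-tuple {mpoly K[N]},
    (forall i : 'I_M, (exists j : 'I_N, tnth lq i = 'X_j)
                      \/ (exists c : K, tnth lq i = c%:MP))
    /\ f = comp_mpoly lq g.

(* Oracle circuits, as straight-line programs.  Node number p of a
   circuit is a gate whose arguments are (indices of) earlier nodes.
   Leaves: variables and constants; inner gates: +, x, and oracle
   gates (with exactly M inputs, where M is the number of variables of
   the oracle polynomial g).  The size of a circuit is its number of
   nodes; its output is its last node.                                 *)
Inductive gate (K : Type) (N : nat) : Type :=
  | GVar of 'I_N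
  | GConst of K
  | GAdd of nat & nat
  | GMul of nat & nat
  | GOrc of seq nat.

Section Circuits.
Variables (K : comNzRingType) (N M : nat) (g : {mpoly K[M]}).

Definition gate_wf (p : nat) (gt : gate K N) : bool :=
  match gt with
  | GVar _ | GConst _ => true
  | GAdd i j | GMul i j => (i < p)%N && (j < p)%N
  | GOrc a => (size a == M) && all (fun i => (i < p)%N) a
  end.

Definition circ_wf (C : seq (gate K N)) : bool :=
  all (fun p => gate_wf p (nth (GConst N 0) C p)) (iota 0 (size C)).

Definition gate_val (vals : seq {mpoly K[N]}) (gt : gate K N)
    : {mpoly K[N]} :=
  match gt with
  | GVar i => 'X_i
  | GConst c => c%:MP
  | GAdd i j => nth 0 vals i + nth 0 vals j
  | GMul i j => nth 0 vals i * nth 0 vals j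
  | GOrc a => comp_mpoly [tuple nth 0 vals (nth 0%N a k) | k < M] g
  end.

Definition circ_vals (C : seq (gate K N)) : seq {mpoly K[N]} :=
  foldl (fun vals gt => rcons vals (gate_val vals gt)) [::] C.

Definition circ_computes (C : seq (gate K N)) (f : {mpoly K[N]}) : Prop :=
  C <> [::] /\ last 0 (circ_vals C) = f.

End Circuits.

Definition oracle_cplx_le (K : comNzRingType) (N M : nat)
    (g : {mpoly K[M]}) (f : {mpoly K[N]}) (c : nat) : Prop :=
  exists C : seq (gate K N),
    circ_wf M C /\ (size C <= c)%N /\ circ_computes g C f.

Section Border.
Variable F : fieldType.

Definition Feps : fieldType := {fraction {poly F}}.
Definition eps : Feps := tofrac ('X : {poly F}).

Definition liftF (N : nat) (p : {mpoly F[N]}) : {mpoly Feps[N]} :=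
  map_mpoly (fun c : F => tofrac (c%:P)) p.
Definition liftE (N : nat) (h : {mpoly {poly F}[N]}) : {mpoly Feps[N]} :=
  map_mpoly (fun c : {poly F} => tofrac c) h.

Definition border_proj (N M : nat) (f : {mpoly F[N]}) (g : {mpoly F[M]})
    : Prop :=
  exists h : {mpoly {poly F}[N]},
    is_proj (liftF f + eps%:MP * liftE h) (liftF g).

Definition border_cplx_le (N M : nat) (g : {mpoly F[M]}) (f : {mpoly F[N]})
    (c : nat) : Prop :=
  exists h : {mpoly {poly F}[N]},
    oracle_cplx_le (liftF g) (liftF f + eps%:MP * liftE h) c.
End Border.

Record pfam (K : comNzRingType) : Type := PFam {
  nvars : nat -> nat;
  fpoly : forall n : nat, {mpoly K[nvars n]}
}.

Definition is_pfamily (K : comNzRingType) (f : pfam K) : Prop :=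
  polybounded (nvars f) /\ polybounded (fun n => mdegree (fpoly f n)).

Definition p_red (K : comNzRingType) (f g : pfam K) : Prop :=
  exists t, polybounded t /\ forall n, is_proj (fpoly f n) (fpoly g (t n)).

Definition c_red (K : comNzRingType) (f g : pfam K) : Prop :=
  exists t, polybounded t /\ exists b, polybounded b /\
    forall n, oracle_cplx_le (fpoly g (t n)) (fpoly f n) (b n).

Definition bp_red (F : fieldType) (f g : pfam F) : Prop :=
  exists t, polybounded t /\ forall n, border_proj (fpoly f n) (fpoly g (t n)).

Definition bc_red (F : fieldType) (f g : pfam F) : Prop :=
  exists t, polybounded t /\ exists b, polybounded b /\
    forall n, border_cplx_le (fpoly g (t n)) (fpoly f n) (b n).

(* Hamiltonian cycle polynomial: variable x_{i,j} is 'X_(mxvec_index i j) *)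
Definition ncycle (n : nat) (s : 'S_n) : bool :=
  [exists x : 'I_n, porbit s x == [set: 'I_n]].

Definition HC (K : comNzRingType) (n : nat) : {mpoly K[n * n]} :=
  \sum_(s : 'S_n | ncycle s) \prod_(i : 'I_n) 'X_(mxvec_index i (s i)).

Definition HCfam (K : comNzRingType) : pfam K := @PFam K (fun n => n * n)%N (@HC K).

Definition VNP (F : fieldType) (f : pfam F) : Prop :=
  is_pfamily f /\ p_red f (HCfam F).

Definition VNPC (F : fieldType) (red : pfam F -> pfam F -> Prop)
    (f : pfam F) : Prop :=
  VNP f /\ red (HCfam F) f.

Definition VNPC_subset (F : fieldType) (r1 r2 : pfam F -> pfam F -> Prop)
    : Prop :=
  forall f : pfam F, VNPC r1 f -> VNPC r2 f.

Definition theorem2_claim (F : fieldType) : Prop :=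
  [/\ VNPC_subset (@p_red F) (@c_red F),
      VNPC_subset (@c_red F) (@bc_red F),
      VNPC_subset (@p_red F) (@bp_red F),
      VNPC_subset (@bp_red F) (@bc_red F) &
   [/\ ~ VNPC_subset (@c_red F) (@p_red F),
       ~ VNPC_subset (@bp_red F) (@p_red F),
       ~ VNPC_subset (@c_red F) (@bp_red F) &
       ~ VNPC_subset (@bc_red F) (@bp_red F)]].

Definition RR : fieldType := Rdefinitions.R.
Definition CC : fieldType := complex Rdefinitions.R.

(* Main.v *)
From HB Require Import structures.
Require Import Defs.
From mathcomp Require Import all_boot all_algebra.
From mathcomp Require Import all_fingroup Rstruct complex mpoly zify ring.

Set Implicit Arguments.
Unset Strict Implicit.
Unset Printing Implicit Defensive.

Import GRing.Theory.
Local Open Scope ring_scope.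

(** Let B_n = HC_n(x) (d \prod_ij (c + x_ij))^2. Products of projections of Hamiltonian cycle
    polynomials are again such projections, by splicing the graphs, and c + x_ij is a projection
    of HC_3; hence B_n and its specialization A_n at c = d = 1 lie in VNP.

    A_n at t x is t^n HC_n(x) up to higher order in t, so interpolation computes HC_n with few
    calls to A_n; yet HC_1 = x is not a border projection of A_n, because a projection of A_n is
    constant or vanishes at x = -1. At c = 1/eps and d = eps^(n^2), B_n becomes HC_n + O(eps);
    yet x is not a projection of B_n, because every variable of B_n contributes a square of a
    nonconstant factor. *)

(** * Cycles as permutations with a single orbit, and block permutations *)

Lemma ncycleE n (s : 'S_n) : ncycle s = (#|porbits s| == 1%N).
Proof.
apply/existsP/cards1P => [[x /eqP xT]|[X sX]].
  exists setT; apply/setP => Y; rewrite inE.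
  apply/imsetP/eqP => [[y _ ->]|->]; last by exists x.
  by rewrite -xT; apply/eqP; rewrite eq_porbit_mem xT inE.
have: X \in porbits s by rewrite sX set11.
case/imsetP => x _ Xx; exists x; apply/eqP/setP => y.
have: porbit s y \in porbits s by apply: imset_f.
by rewrite sX inE Xx => /eqP <-; rewrite porbit_id inE.
Qed.

Section BlockPerm.
Variables n m : nat.

Definition block_fun (s : 'S_n) (t : 'S_m) (i : 'I_(n + m)) : 'I_(n + m) :=
  match split i with inl a => lshift m (s a) | inr b => rshift n (t b) end.

Lemma block_funl s t a : block_fun s t (lshift m a) = lshift m (s a).
Proof. by rewrite /block_fun (unsplitK (inl a)). Qed.

Lemma block_funr s t b : block_fun s t (rshift n b) = rshift n (t b).
Proof. by rewrite /block_fun (unsplitK (inr b)). Qed.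

Lemma block_fun_inj s t : injective (block_fun s t).
Proof.
move=> i j; case: (split_ordP i) => a ->; case: (split_ordP j) => b ->;
  rewrite ?block_funl ?block_funr => /eqP.
- by rewrite eq_lshift => /eqP/perm_inj->.
- by rewrite eq_lrshift.
- by rewrite eq_rlshift.
- by rewrite eq_rshift => /eqP/perm_inj->.
Qed.

Definition block_perm (st : 'S_n * 'S_m) : 'S_(n + m) :=
  perm (@block_fun_inj st.1 st.2).

Lemma block_perml st a : block_perm st (lshift m a) = lshift m (st.1 a).
Proof. by rewrite permE block_funl. Qed.

Lemma block_permr st b : block_perm st (rshift n b) = rshift n (st.2 b).
Proof. by rewrite permE block_funr. Qed.

Lemma block_perm_inj : injective block_perm.
Proof.
move=> [s t] [s' t'] /permP E; congr pair; apply/permP => a.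
  by have /eqP := E (lshift m a); rewrite !block_perml eq_lshift => /eqP.
by have /eqP := E (rshift n a); rewrite !block_permr eq_rshift => /eqP.
Qed.

Lemma porbit_block_perml st a :
  porbit (block_perm st) (lshift m a) = lshift m @: porbit st.1 a.
Proof.
have E i : (block_perm st ^+ i)%g (lshift m a) = lshift m ((st.1 ^+ i)%g a).
  by rewrite !permX; elim: i => //= i ->; rewrite block_perml.
apply/setP => y; apply/porbitP/imsetP => [[i ->]|[b /porbitP[i ->] ->]].
  by exists ((st.1 ^+ i)%g a); rewrite ?mem_porbit.
by exists i.
Qed.

Lemma porbit_block_permr st b :
  porbit (block_perm st) (rshift n b) = @rshift n m @: porbit st.2 b.
Proof.
have E i : (block_perm st ^+ i)%g (rshift n b) = rshift n ((st.2 ^+ i)%g b).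
  by rewrite !permX; elim: i => //= i ->; rewrite block_permr.
apply/setP => y; apply/porbitP/imsetP => [[i ->]|[c /porbitP[i ->] ->]].
  by exists ((st.2 ^+ i)%g b); rewrite ?mem_porbit.
by exists i.
Qed.

Lemma card_porbits_block_perm st :
  #|porbits (block_perm st)| = (#|porbits st.1| + #|porbits st.2|)%N.
Proof.
pose L (X : {set 'I_n}) := @lshift n m @: X.
pose R (X : {set 'I_m}) := @rshift n m @: X.
have -> : porbits (block_perm st) = L @: porbits st.1 :|: R @: porbits st.2.
  apply/setP => X; rewrite inE; apply/imsetP/orP => [[i _ ->]|].
    case: (split_ordP i) => a ->; [left|right].
      by rewrite porbit_block_perml; do 2! apply: imset_f.
    by rewrite porbit_block_permr; do 2! apply: imset_f.
  case=> /imsetP[Y /imsetP[a _ ->] ->].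
    by exists (lshift m a); rewrite // porbit_block_perml.
  by exists (rshift n a); rewrite // porbit_block_permr.
rewrite cardsU disjoint_setI0 ?cards0 ?subn0.
  have LI : injective L by exact/imset_inj/lshift_inj.
  have RI : injective R by exact/imset_inj/rshift_inj.
  by rewrite (card_imset (porbits _) LI) (card_imset (porbits _) RI).
rewrite -setI_eq0; apply/eqP/setP => X; rewrite !inE; apply/negP => /andP[].
case/imsetP=> Y /imsetP[a _ ->] -> /imsetP[Z _] /setP/(_ (lshift m a)).
rewrite imset_f ?porbit_id // => /esym/imsetP[b _ /eqP].
by rewrite eq_lrshift.
Qed.

Lemma block_permP (s : 'S_(n + m)) :
  (forall a, exists b, s (lshift m a) = lshift m b) ->
  (forall a, exists b, s (rshift n a) = rshift n b) ->
  s \in codom block_perm.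
Proof.
move=> sl sr.
(* The else values are defaults: by [sl] and [sr] the image always lies in the expected block. *)
pose f a := if split (s (lshift m a)) is inl b then b else a.
pose g a := if split (s (rshift n a)) is inr b then b else a.
have fE a : s (lshift m a) = lshift m (f a).
  by rewrite /f; have [b ->] := sl a; rewrite (unsplitK (inl b)).
have gE a : s (rshift n a) = rshift n (g a).
  by rewrite /g; have [b ->] := sr a; rewrite (unsplitK (inr b)).
have fI : injective f.
  move=> a b ab; apply: (@lshift_inj n m); apply: (@perm_inj _ s).
  by rewrite !fE ab.
have gI : injective g.
  move=> a b ab; apply: (@rshift_inj n m); apply: (@perm_inj _ s).
  by rewrite !gE ab.
apply/codomP; exists (perm fI, perm gI); apply/permP => i.
case: (split_ordP i) => a ->; rewrite ?block_perml ?block_permr permE ?fE ?gE //.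
Qed.

End BlockPerm.

(** * Multiplicativity of Hamiltonian cycle sums *)

Section CycleSum.
Variable R : comNzRingType.

(** The Hamiltonian cycle sum of the weighted digraph with adjacency matrix [A], over any ring, so
    that substitutions act on matrix entries. *)
Definition hc n (A : 'M[R]_n) : R :=
  \sum_(s : 'S_n | ncycle s) \prod_i A i (s i).

(* The two graphs are spliced by exchanging the outgoing edges of one vertex of each. *)
Lemma hc_mul n m (A : 'M[R]_n.+1) (B : 'M[R]_m.+1) :
  hc A * hc B =
    hc (xrow (lshift m.+1 ord0) (rshift n.+1 ord0) (block_mx A 0 0 B)).
Proof.
set x := lshift _ _; set y := rshift _ _; set D := block_mx _ _ _ _.
set t := tperm x y.
(* Absorbing the row exchange into the permutation leaves the matrix [D] itself, with the cycle
   condition now on [t * s]. *)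
rewrite /hc [RHS](reindex_inj (mulgI t)) /=.
transitivity (\sum_(s | ncycle (t * s)%g) \prod_i D i (s i)); last first.
  apply: eq_bigr => s _; rewrite [LHS](reindex_inj (@perm_inj _ t)) /=.
  by apply: eq_bigr => i _; rewrite permM [RHS]mxE.
rewrite (bigID (mem (codom (@block_perm n.+1 m.+1)))) /=.
(* A permutation that crosses between the blocks meets a zero entry of [D], so only block
   permutations contribute. *)
rewrite [X in _ = _ + X]big1 ?addr0; last first.
  move=> s /andP[_ sN]; apply/eqP; apply: contraNT sN => nz.
  have nzi i : D i (s i) != 0.
    by apply: contra nz => /eqP E; rewrite (bigD1 i) //= E mul0r.
  apply: block_permP => a.
    have := nzi (lshift _ a); case: (split_ordP (s (lshift _ a))) => b ->; first by exists b.
    by rewrite block_mxEur mxE eqxx.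
  have := nzi (rshift _ a); case: (split_ordP (s (rshift _ a))) => b ->; last by exists b.
  by rewrite block_mxEdl mxE eqxx.
pose inB := @block_perm n.+1 m.+1 @: setT.
have inBE s : (s \in codom (@block_perm n.+1 m.+1)) = (s \in inB).
  by apply/codomP/imsetP => [[st ->]|[st _ ->]]; exists st.
rewrite (eq_bigl (fun s => (s \in inB) && ncycle (t * s)%g)); last first.
  by move=> s; rewrite inBE andbC.
rewrite big_imset_cond /=; last by move=> ? ? _ _; apply: block_perm_inj.
rewrite big_distrlr pair_big_dep /=; apply: eq_big => [st|st _].
  rewrite inE /= !ncycleE.
  have xy : x \notin porbit (block_perm st) y.
    rewrite /y porbit_block_permr; apply/negP => /imsetP[b _ /eqP].
    by rewrite eq_lrshift.
  (* As [x] and [y] lie in different orbits, the transposition merges these two: the orbit count of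
     the product is the sum of the two counts minus one. Both counts are positive, so it equals 1
     exactly when both do. *)
  have := porbits_mul_tperm (block_perm st) x y.
  rewrite xy eq_lrshift card_porbits_block_perm /= => E.
  have p1 : (0 < #|porbits st.1|)%N.
    by apply/card_gt0P; exists (porbit st.1 ord0); apply: imset_f.
  have p2 : (0 < #|porbits st.2|)%N.
    by apply/card_gt0P; exists (porbit st.2 ord0); apply: imset_f.
  apply/andP/eqP; move: E p1 p2; move: #|_| #|_| #|_| => a b c; rewrite -/t; lia.
rewrite big_split_ord /=; congr (_ * _); apply: eq_bigr => i _.
  by rewrite block_perml block_mxEul.
by rewrite block_permr block_mxEdr.
Qed.
End CycleSum.

(** * The two 3-cycles, and sums of two weights as cycle sums *)

Lemma ncycle_fix n (s : 'S_n.+2) i : ncycle s -> s i != i.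
Proof.
move=> /existsP[x /eqP xT]; apply/eqP => si.
have y_i y : y = i.
  have: y \in porbit s i.
    have -> : porbit s i = setT.
      by rewrite -xT; apply/eqP; rewrite eq_porbit_mem xT inE.
    by rewrite inE.
  by case/porbitP => k ->; rewrite permX; elim: k => //= k ->.
by have := y_i ord0; rewrite -(y_i ord_max).
Qed.

(** Translations of Z/3; for [a] equal to 1 and -1 they are the two 3-cycles. *)
Definition rot3 (a : 'I_3) : 'S_3 := perm (@addIr _ a).

Lemma forall_ord3 (P : 'I_3 -> Prop) : P 0 -> P 1 -> P (-1) -> forall i, P i.
Proof.
move=> P0 P1 P2 [[|[|[|//]]] lt_i].
- by congr P: P0; apply: val_inj.
- by congr P: P1; apply: val_inj.
- by congr P: P2; apply: val_inj.
Qed.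

Lemma rot3_ncycle a : a != 0 -> ncycle (rot3 a).
Proof.
move=> a0; apply/existsP; exists 0; apply/eqP/setP => y; rewrite inE.
apply/porbitP.
have E k : (rot3 a ^+ k)%g 0 = a *+ k.
  by rewrite permX; elim: k => //= k ->; rewrite permE -mulrSr.
suff: exists k, y == a *+ k by case=> k /eqP ->; exists k; rewrite E.
move: a y a0 {E}; apply: forall_ord3 => // y _; move: y; apply: forall_ord3;
  by [exists 0%N|exists 1%N|exists 2].
Qed.

Lemma ncycle3E (s : 'S_3) : ncycle s = (s \in [set rot3 1; rot3 (-1)]).
Proof.
apply/idP/set2P => [sc|[] ->]; try exact: rot3_ncycle.
have h (i j : 'I_3) : i != j -> s i != s j by rewrite (inj_eq perm_inj).
have := (h 0 1 isT, h 0 (-1) isT, h 1 (-1) isT).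
have := (ncycle_fix 0 sc, ncycle_fix 1 sc, ncycle_fix (-1) sc).
have e i : s i \in [:: 0; 1; -1] by move: (s i); apply: forall_ord3.
move: (e 0) (e 1) (e (-1)); rewrite !inE.
move=> /or3P[]/eqP E0 /or3P[]/eqP E1 /or3P[]/eqP E2;
  rewrite ?E0 ?E1 ?E2 //= => -[[n0 n1] n2] [[n01 n02] n12] //.
  by left; apply/permP; apply: forall_ord3; rewrite permE ?E0 ?E1 ?E2; apply/eqP.
by right; apply/permP; apply: forall_ord3; rewrite permE ?E0 ?E1 ?E2; apply/eqP.
Qed.

Section CycleSum3.
Variable R : comNzRingType.

(** One 3-cycle leaves vertex 0 towards 1, the other towards 2; putting [a] and [b] on these edges
    and 1 on the remaining ones gives the sum. Loops lie on no 3-cycle, so their weights are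
    arbitrary. *)
Definition linear_mx (a b : R) : 'M[R]_3 :=
  \matrix_(i, j) if i == 0 then if j == 1 then a else b else 1.

Lemma hc_linear a b : hc (linear_mx a b) = a + b.
Proof.
rewrite /hc (eq_bigl _ _ ncycle3E) big_setU1 ?big_set1 /=; last first.
  by rewrite inE; apply/eqP => /permP/(_ 0); rewrite !permE.
by rewrite !big_ord_recl !big_ord0 !mxE !permE /= !mulr1.
Qed.
End CycleSum3.

(** * Closure properties of polynomial bounds, through bounds of the form (n + 2)^c *)

Lemma polyboundedE t :
  polybounded t <-> exists c, forall n, (t n <= (n + 2) ^ c)%N.
Proof.
split=> -[c tc].
  exists (c + c)%N => n; apply: leq_trans (tc n) _; rewrite expnD.
  case: c {tc} => [|c] //; rewrite -mulnSr.
  apply: leq_mul.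
    by apply: leq_trans (ltnW (ltn_expl _ (isT : 1 < 2)%N)) _; rewrite leq_exp2r ?leq_addl.
  by rewrite ltn_exp2r //; lia.
(* For n >= 1 the estimate n + 2 <= 3n gives (n + 2)^c <= 3^c n^c; at n = 0 the additive term 3^c
   suffices. *)
exists (3 ^ c)%N => n; apply: leq_trans (tc n) _.
case: n => [|n]; first by case: c {tc} => // c; rewrite ltnW // ltn_addl // ltn_exp2r.
apply: leq_trans (leq_addr _ _).
apply: (@leq_trans (3 ^ c * n.+1 ^ c)); last first.
  by rewrite leq_pmul2l ?expn_gt0 // leq_pexp2l // ltnW // ltn_expl.
by rewrite -expnMn; case: c {tc} => // c; rewrite leq_exp2r //; lia.
Qed.

Lemma polybounded_le u t :
  (forall n, t n <= u n)%N -> polybounded u -> polybounded t.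
Proof. by move=> tu [c uc]; exists c => n; apply: leq_trans (tu n) (uc n). Qed.

Lemma polybounded_const c : polybounded (fun=> c).
Proof. by exists c => n; rewrite leq_addl. Qed.

Lemma polybounded_id : polybounded id.
Proof. by exists 1%N => n; lia. Qed.

Lemma polyboundedD t u :
  polybounded t -> polybounded u -> polybounded (fun n => t n + u n)%N.
Proof.
move=> /polyboundedE[a ta] /polyboundedE[b ub]; apply/polyboundedE.
exists (a + b).+1 => n; apply: leq_trans (leq_add (ta n) (ub n)) _.
rewrite expnS expnD.
have: (0 < (n + 2) ^ a)%N by rewrite expn_gt0 addn2.
have: (0 < (n + 2) ^ b)%N by rewrite expn_gt0 addn2.
by move: (expn _ a) (expn _ b) => x y; nia.
Qed.

Lemma polyboundedM t u :
  polybounded t -> polybounded u -> polybounded (fun n => t n * u n)%N.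
Proof.
move=> /polyboundedE[a ta] /polyboundedE[b ub]; apply/polyboundedE.
by exists (a + b)%N => n; rewrite expnD leq_mul.
Qed.

Lemma polybounded_comp t u :
  polybounded t -> polybounded u -> polybounded (fun n => t (u n)).
Proof.
move=> /polyboundedE[a ta] /polyboundedE[b ub]; apply/polyboundedE.
(* With x = (n + 2)^b >= 1, u(n) + 2 <= x + 2 <= 4x <= (n + 2)^(b + 2). *)
exists (b.+2 * a)%N => n; apply: leq_trans (ta _) _.
rewrite expnM; case: a {ta} => // a; rewrite leq_exp2r // !expnS.
have: (0 < (n + 2) ^ b)%N by rewrite expn_gt0 addn2.
by have := ub n; move: (expn _ b) => x; nia.
Qed.

(** * Projections of Hamiltonian cycle polynomials *)

Definition simple (K : comNzRingType) N (p : {mpoly K[N]}) :=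
  (exists j, p = 'X_j) \/ (exists c, p = c%:MP).

Lemma simpleX (K : comNzRingType) N j : @simple K N 'X_j.
Proof. by left; exists j. Qed.

Lemma simpleC (K : comNzRingType) N c : @simple K N c%:MP.
Proof. by right; exists c. Qed.

Lemma simple0 (K : comNzRingType) N : @simple K N 0.
Proof. by rewrite -mpolyC0; apply: simpleC. Qed.

Lemma simple1 (K : comNzRingType) N : @simple K N 1.
Proof. by rewrite -mpolyC1; apply: simpleC. Qed.

#[local] Hint Resolve simpleX simpleC simple0 simple1 : core.

Lemma hc_map (R S : comNzRingType) (phi : {rmorphism R -> S}) n (A : 'M[R]_n) :
  phi (hc A) = hc (map_mx phi A).
Proof.
rewrite /hc rmorph_sum; apply: eq_bigr => s _.
by rewrite rmorph_prod; apply: eq_bigr => i _; rewrite mxE.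
Qed.

Lemma hcZ (R : comNzRingType) n (c : R) (A : 'M[R]_n) :
  hc (c *: A) = c ^+ n * hc A.
Proof.
rewrite /hc mulr_sumr; apply: eq_bigr => s _.
under eq_bigr do rewrite mxE.
by rewrite big_split prodr_const card_ord.
Qed.

Lemma HCE (K : comNzRingType) n :
  HC K n = hc (\matrix_(i, j) 'X_(mxvec_index i j)).
Proof. by apply: eq_bigr => s _; apply: eq_bigr => i _; rewrite mxE. Qed.

(** Replaces tuples indexed by [mxvec_index] with matrices, to which [hc_mul] and [hc_linear]
    apply. *)
Lemma is_proj_HC (K : comNzRingType) N n (f : {mpoly K[N]}) :
  is_proj f (HC K n) <->
  exists2 A : 'M_n, (forall i j, simple (A i j)) & f = hc A.
Proof.
split=> [[lq [lqS ->]]|[A AS ->]].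
  exists (\matrix_(i, j) tnth lq (mxvec_index i j)) => [i j|].
    by rewrite mxE; apply: lqS.
  rewrite HCE hc_map; congr hc; apply/matrixP => i j.
  by rewrite !mxE /= comp_mpolyXU -tnth_nth.
exists [tuple mxvec A 0 k | k < n * n]; split=> [k|].
  by rewrite tnth_mktuple; case/mxvec_indexP: k => i j; rewrite mxvecE; apply: AS.
rewrite HCE hc_map; congr hc; apply/matrixP => i j.
by rewrite !mxE /= comp_mpolyXU -tnth_nth tnth_mktuple mxvecE.
Qed.

(** The spliced matrix of [hc_mul] contains only entries of the two given matrices and zeros, so it
    is again an admissible substitution. *)
Lemma is_projM (K : comNzRingType) N n m (f g : {mpoly K[N]}) :
  (0 < n)%N -> (0 < m)%N -> is_proj f (HC K n) -> is_proj g (HC K m) ->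
  is_proj (f * g) (HC K (n + m)).
Proof.
case: n m => [|n] [|m] // _ _ /is_proj_HC[A AS ->] /is_proj_HC[B BS ->]; apply/is_proj_HC.
rewrite hc_mul; eexists; last by [].
move=> i j; rewrite mxE; move: (tperm _ _ _) => k.
case: (split_ordP k) => a ->; case: (split_ordP j) => b ->;
  by rewrite ?block_mxEul ?block_mxEur ?block_mxEdl ?block_mxEdr ?mxE.
Qed.

Lemma is_proj_simple (K : comNzRingType) N (p : {mpoly K[N]}) :
  simple p -> is_proj p (HC K 1).
Proof.
move=> pS; apply/is_proj_HC; exists (const_mx p) => [i j|]; first by rewrite mxE.
rewrite /hc (big_pred1 1%g) => [|s]; first by rewrite big_ord1 mxE.
have -> : s = 1%g by apply/permP => i; rewrite !ord1.
rewrite /= eqxx; apply/existsP; exists ord0; apply/eqP/setP => i.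
by rewrite inE ord1 porbit_id.
Qed.

Lemma is_projD_simple (K : comNzRingType) N (p q : {mpoly K[N]}) :
  simple p -> simple q -> is_proj (p + q) (HC K 3).
Proof.
move=> pS qS; apply/is_proj_HC; exists (linear_mx p q); last by rewrite hc_linear.
by move=> i j; rewrite mxE; case: ifP => // _; case: ifP.
Qed.

Lemma is_proj0 (K : comNzRingType) N n : is_proj (0 : {mpoly K[N]}) (HC K n).
Proof.
apply/is_proj_HC; exists 0 => [i j|]; first by rewrite mxE.
rewrite /hc big1 // => s /existsP[i _].
by rewrite (bigD1 i) //= mxE mul0r.
Qed.

Lemma is_projM_prod (K : comNzRingType) N n I (r : seq I) (p : {mpoly K[N]}) F :
  (0 < n)%N -> is_proj p (HC K n) -> (forall i, is_proj (F i) (HC K 3)) ->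
  is_proj (p * \prod_(i <- r) F i) (HC K (n + 3 * size r)).
Proof.
move=> n0 pP FP; elim: r => [|i r IH]; first by rewrite big_nil mulr1 muln0 addn0.
rewrite big_cons mulrCA mulrC /= mulnS addnCA addnC.
by apply: is_projM; rewrite // addn_gt0 n0.
Qed.

Lemma size_index_ord n : size (index_enum 'I_n) = n.
Proof. by rewrite -[index_enum _]enumT -cardT card_ord. Qed.

(** The factor 3 is not sharp; it absorbs the slack of [msizeM_le]. *)
Lemma msize_prod_le (K : comNzRingType) N I (r : seq I) (F : I -> {mpoly K[N]}) :
  (forall i, msize (F i) <= 2)%N -> (msize (\prod_(i <- r) F i) <= (3 * size r).+1)%N.
Proof.
move=> F2; elim: r => [|i r IH]; first by rewrite big_nil msize1.
rewrite big_cons; apply: leq_trans (msizeM_le _ _) _ => /=.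
by rewrite ltnS (leq_trans (leq_add (F2 i) IH)) // mulnS.
Qed.

Lemma mdegree_proj_HC (K : comNzRingType) N n (f : {mpoly K[N]}) :
  is_proj f (HC K n) -> (mdegree f <= 3 * n)%N.
Proof.
move=> /is_proj_HC[A AS ->]; rewrite /mdegree.
suff: (msize (hc A) <= (3 * n).+1)%N by lia.
apply: (big_ind (fun p => msize p <= (3 * n).+1)%N) => [|p q pn qn|s _].
- by rewrite msize0.
- by apply: leq_trans (msizeD_le _ _) _; rewrite geq_max pn.
have := @msize_prod_le K N _ (index_enum 'I_n) (fun i => A i (s i)).
rewrite size_index_ord; apply => i.
case: (AS i (s i)) => [[j ->]|[c ->]]; first by rewrite msizeX mdeg1.
by rewrite msizeC; case: (c == 0).
Qed.

(** The degree bound of a p-family comes for free, since a projection of [HC K n] has degree at most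
    3n. *)
Lemma VNP_proj (F : fieldType) (f : pfam F) :
  polybounded (nvars f) -> p_red f (HCfam F) -> VNP f.
Proof.
move=> nf pf; split=> //; split=> //; case: pf => t [tb tP].
apply: polybounded_le (polyboundedM (polybounded_const 3) tb) => n.
exact: mdegree_proj_HC (tP n).
Qed.

(** * The padded families and their membership in VNP *)

Definition padded (S : comNzRingType) n (x : 'I_(n * n) -> S) (c d : S) : S :=
  hc (\matrix_(i, j) x (mxvec_index i j)) * (d * \prod_k (c + x k)) ^+ 2.

(** Substitutions, evaluations and coefficient extensions are all ring morphisms, so each of them
    acts on [x], [c] and [d] only. *)
Lemma padded_map (R S : comNzRingType) (phi : {rmorphism R -> S}) n
    (x : 'I_(n * n) -> R) c d :
  phi (padded x c d) = padded (phi \o x) (phi c) (phi d).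
Proof.
rewrite /padded rmorphM hc_map rmorphXn rmorphM rmorph_prod; congr (hc _ * (_ * _) ^+ 2).
  by apply/matrixP => i j; rewrite !mxE.
by apply: eq_bigr => k _; rewrite rmorphD.
Qed.

Lemma eq_padded (S : comNzRingType) n (x y : 'I_(n * n) -> S) c d :
  x =1 y -> padded x c d = padded y c d.
Proof.
move=> xy; rewrite /padded; congr (hc _ * (_ * _) ^+ 2).
  by apply/matrixP => i j; rewrite !mxE.
by apply: eq_bigr => k _; rewrite xy.
Qed.

(** [n] vertices for the cycle polynomial and, for each of the two copies of the product, one for
    [d] and three for each of the n^2 factors c + x_k. *)
Definition padded_dim n := (n + ((1 + 3 * (n * n)) + (1 + 3 * (n * n))))%N.

Lemma is_proj_padded (K : comNzRingType) N n (x : 'I_(n * n) -> {mpoly K[N]}) c d :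
  (forall k, simple (x k)) -> simple c -> simple d ->
  is_proj (padded x c d) (HC K (padded_dim n)).
Proof.
rewrite /padded_dim; set s := (1 + _)%N.
move=> xS cS dS; case: n @s x xS => [|n] s x xS.
  (* Splicing needs nonempty graphs. For n = 0 no permutation counts as a cycle, so [hc] is 0. *)
  rewrite /padded [hc _]big1 ?mul0r; first exact: is_proj0.
  by move=> t /existsP[[]].
have dP : is_proj (d * \prod_k (c + x k)) (HC K s).
  have := @is_projM_prod K N 1 _ (index_enum 'I_(n.+1 * n.+1)) d (fun k => c + x k).
  rewrite size_index_ord; apply=> // [|k]; first exact: is_proj_simple.
  exact: is_projD_simple.
rewrite /padded expr2; apply: is_projM => //; last exact: is_projM.
by apply/is_proj_HC; eexists; last by []; move=> i j; rewrite mxE.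
Qed.

Lemma polybounded_padded_dim : polybounded padded_dim.
Proof.
have sq : polybounded (fun n => 1 + 3 * (n * n))%N.
  apply: polyboundedD; first exact: polybounded_const.
  apply: polyboundedM; first exact: polybounded_const.
  by apply: polyboundedM; apply: polybounded_id.
by apply: polyboundedD (polyboundedD _ _) => //; apply: polybounded_id.
Qed.

Definition padHC (K : comNzRingType) : pfam K :=
  @PFam K (fun n => n * n)%N (fun n => padded (fun k => 'X_k) 1 1).

(** The last two variables stand for [c] and [d], so that a border projection can set them to powers
    of eps. *)
Definition scaledHC (K : comNzRingType) : pfam K :=
  @PFam K (fun n => n * n + 2)%N
    (fun n => padded (fun k => 'X_(lshift 2 k)) 'X_(rshift (n * n) ord0)
                     'X_(rshift (n * n) ord_max)).

Lemma VNP_padHC (F : fieldType) : VNP (padHC F).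
Proof.
apply: VNP_proj => /=.
  by apply: polyboundedM; apply: polybounded_id.
by exists padded_dim; split=> [|n]; [apply: polybounded_padded_dim|apply: is_proj_padded].
Qed.

Lemma VNP_scaledHC (F : fieldType) : VNP (scaledHC F).
Proof.
apply: VNP_proj => /=.
  apply: polyboundedD; last exact: polybounded_const.
  by apply: polyboundedM; apply: polybounded_id.
by exists padded_dim; split=> [|n]; [apply: polybounded_padded_dim|apply: is_proj_padded].
Qed.

(** * The polynomial x is not a projection of the scaled family *)

Lemma HC1E (K : comNzRingType) : HC K 1 = 'X_(mxvec_index ord0 ord0).
Proof.
rewrite /HC (big_pred1 1%g) => [|s]; first by rewrite big_ord1 perm1.
have -> : s = 1%g by apply/permP => i; rewrite !ord1.
rewrite /= eqxx; apply/existsP; exists ord0; apply/eqP/setP => i.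
by rewrite inE ord1 porbit_id.
Qed.

(** Applied to the ring of HC_1, which has one variable, this makes sizes and divisibility in
    [{poly F}] available. *)
Definition univariate (F : fieldType) N (p : {mpoly F[N]}) : {poly F} :=
  mmap polyC (fun=> 'X) p.
HB.instance Definition _ (F : fieldType) N := GRing.RMorphism.copy (@univariate F N) (mmap polyC (fun=> 'X)).

Lemma univariate_simple (F : fieldType) N (p : {mpoly F[N]}) :
  simple p -> univariate p = 'X \/ (size (univariate p) <= 1)%N.
Proof.
case=> [[j ->]|[c ->]]; [left|right]; first by rewrite /univariate mmapX mmap1U.
by rewrite /univariate mmapC size_polyC_leq1.
Qed.

Section NotProjection.
Variable F : fieldType.
Hypothesis F2 : (2%:R : F) != 0.

(** A polynomial whose square divides ['X] is constant, so [d] and every c + x_k are constant. This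
    forces [c] and all x_k to be constant, and then the whole expression is constant, unlike
    ['X]. *)
Lemma polyX_neq_padded n (x : 'I_(n * n) -> {poly F}) c d :
  (forall k, x k = 'X \/ size (x k) <= 1)%N -> c = 'X \/ (size c <= 1)%N ->
  d = 'X \/ (size d <= 1)%N -> padded x c d != 'X.
Proof.
move=> xS cS dS; case: n x xS => [|n] x xS.
  rewrite /padded [hc _]big1 ?mul0r; first by rewrite eq_sym polyX_eq0.
  by move=> t /existsP[[]].
apply/eqP => E; pose p := d * \prod_k (c + x k).
have p0 : p != 0.
  by apply: contra_eq_neq E => p0; rewrite /padded -/p p0 expr0n mulr0 eq_sym polyX_eq0.
have h0 : hc (\matrix_(i, j) x (mxvec_index i j)) != 0.
  by apply: contra_eq_neq E => h0; rewrite /padded h0 mul0r eq_sym polyX_eq0.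
have p1 : (size p <= 1)%N.
  have := congr1 (fun q : {poly F} => size q) E.
  rewrite /padded -/p size_mul ?expf_neq0 // expr2 size_mul // size_polyX.
  by move: h0 p0; rewrite -!size_poly_gt0; move: (size _) (size p) => u v; lia.
have small q : q %| p -> (size q <= 1)%N by move=> /(dvdp_leq p0)/leq_trans->.
have d1 : (size d <= 1)%N by apply: small; apply: dvdp_mulr.
have cx1 k : (size (c + x k)%R <= 1)%N.
  by apply: small; apply: dvdp_mull; rewrite (bigD1 k) //= dvdp_mulr.
have X1 (q : {poly F}) : (size q <= 1)%N -> (size ('X + q)%R <= 1)%N = false.
  by move=> q1; rewrite size_polyDl size_polyX.
(* If [c] were ['X], then c + x_k would be 'X plus a constant or 2 'X, of degree one in either case
   because 2 is nonzero. *)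
have c1 : (size c <= 1)%N.
  case: cS => // cX; have := cx1 (mxvec_index ord0 ord0).
  rewrite cX; case: (xS (mxvec_index ord0 ord0)) => [->|/X1->//].
  by rewrite -mulr2n -scaler_nat size_scale // size_polyX.
have x1 k : (size (x k) <= 1)%N.
  by case: (xS k) => // xX; have := cx1 k; rewrite xX addrC X1.
have : padded x c d = (padded (fun k => (x k)`_0) c`_0 d`_0)%:P.
  rewrite padded_map /= -!size1_polyC //; apply: eq_padded => k /=.
  exact: size1_polyC.
rewrite E => /(congr1 (fun q : {poly F} => size q)).
by rewrite size_polyX size_polyC; case: (_ == 0).
Qed.

Lemma HC1_not_proj_scaledHC n : ~ is_proj (HC F 1) (fpoly (scaledHC F) n).
Proof.
case=> lq [lqS] /(congr1 (@univariate F _)); rewrite HC1E.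
rewrite {1}/univariate mmapX mmap1U => /esym/eqP; apply/negP.
rewrite !padded_map; apply: polyX_neq_padded => [k||];
  apply: univariate_simple; rewrite /= comp_mpolyXU -tnth_nth; apply: lqS.
Qed.
End NotProjection.

(** * Border projections: x from the padded family, and HC from the scaled one *)

Lemma meval_map_mpoly (R S : comNzRingType) (phi : {rmorphism R -> S}) N
    (p : {mpoly R[N]}) v :
  (map_mpoly phi p).@[phi \o v] = phi p.@[v].
Proof.
elim/mpolyind: p => [|c m p _ _ IH]; first by rewrite !rmorph0.
rewrite -mul_mpolyC !rmorphD !rmorphM /= IH.
rewrite map_mpolyC map_mpolyX !mevalC !mevalX rmorph_prod; congr (_ * _ + _).
by apply: eq_bigr => i _; rewrite rmorphXn.
Qed.

Section BorderProjection.
Variable F : fieldType.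

(** Together with [eps_const], a named form of the coefficient maps in [liftE] and [liftF], to carry
    their ring morphism structure. *)
Definition eps_emb : {poly F} -> Feps F := fun c => tofrac c.
HB.instance Definition _ := GRing.RMorphism.copy eps_emb (@tofrac {poly F}).
Definition eps_const : F -> Feps F := fun c => tofrac c%:P.
HB.instance Definition _ := GRing.RMorphism.copy eps_const (@tofrac {poly F} \o polyC).

Lemma liftEE N : @liftE F N = map_mpoly eps_emb. Proof. by []. Qed.

HB.instance Definition _ N := GRing.RMorphism.copy (@liftF F N) (map_mpoly eps_const).
HB.instance Definition _ N := GRing.RMorphism.copy (@liftE F N) (map_mpoly eps_emb).

Lemma eps_neq0 : eps F != 0.
Proof. by rewrite tofrac_eq0 polyX_eq0. Qed.

Lemma liftFX N i : liftF ('X_i : {mpoly F[N]}) = 'X_i.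
Proof. exact: (map_mpolyX eps_const). Qed.

Lemma liftEX N i : liftE ('X_i : {mpoly {poly F}[N]}) = 'X_i.
Proof. exact: (map_mpolyX eps_emb). Qed.

Lemma liftEC N c : liftE (c%:MP : {mpoly {poly F}[N]}) = (eps_emb c)%:MP.
Proof. exact: (map_mpolyC _ eps_emb). Qed.

Lemma liftED N : {morph @liftE F N : p q / p + q}. Proof. exact: rmorphD. Qed.
Lemma liftEM N : {morph @liftE F N : p q / p * q}. Proof. exact: rmorphM. Qed.

Lemma meval_liftE N (h : {mpoly {poly F}[N]}) v :
  (liftE h).@[eps_emb \o v] = eps_emb h.@[v].
Proof. exact: (meval_map_mpoly eps_emb). Qed.

(** At eps = 0 the polynomial takes the value [c]. *)
Lemma eps_perturb_neq0 (c : F) g :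
  c != 0 -> eps_const c + eps F * eps_emb g != 0.
Proof.
move=> c0; rewrite -[eps F]/(eps_emb 'X) -[eps_const c]/(eps_emb c%:P).
rewrite -rmorphM -rmorphD tofrac_eq0; apply/eqP => /(congr1 (horner^~ 0)).
by rewrite !hornerE => /eqP; apply/negP.
Qed.

(** If the variable is substituted somewhere, the factor 1 + x kills the value at -1; otherwise the
    values at 0 and 1 agree. This yields -1 + O(eps) = 0 or 1 + O(eps) = 0. *)
Lemma HC1_not_border_proj_padHC n : ~ border_proj (HC F 1) (fpoly (padHC F) n).
Proof.
case=> h [lq [lqS]]; rewrite HC1E liftFX !padded_map !rmorph1.
set i0 := mxvec_index _ _; pose x := tnth lq.
rewrite (@eq_padded _ _ _ x) => [E|k]; last by rewrite /= liftFX comp_mpolyXU -tnth_nth.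
(* At a point of F the error polynomial takes a value in F[eps], so it remains a multiple of eps
   without denominators. *)
have ev (v : F) : eps_const v + eps F * eps_emb h.@[fun=> v%:P] =
    padded (fun k => (x k).@[fun=> eps_const v]) 1 1.
  have := congr1 (meval (fun=> eps_const v)) E.
  rewrite padded_map !rmorph1 rmorphD rmorphM /= mevalXU mevalC => <-.
  by rewrite -meval_liftE.
have [/existsP[k /eqP xk]|/existsPn nX] := boolP [exists k, x k == 'X_i0].
  have := ev (-1); rewrite /padded (bigD1 k) //= xk mevalXU rmorphN1 subrr.
  rewrite mul0r mulr0 expr0n mulr0 -(rmorphN1 eps_const); apply/eqP.
  by rewrite eps_perturb_neq0 // oppr_eq0 oner_eq0.
have xC k : exists c, x k = c%:MP.
  case: (lqS k) => [[j xj]|//]; case/negP: (nX k); apply/eqP; rewrite [x k]xj.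
  by case/mxvec_indexP: j {xj} => a b; rewrite !ord1.
(* All substituted values are constants, so the values at 1 and 0 coincide; subtracting leaves 1 +
   eps (h(1) - h(0)) = 0. *)
have := ev 1; rewrite (@eq_padded _ _ _ (fun k => (x k).@[fun=> eps_const 0])) => [|k].
  rewrite -ev rmorph0 add0r => /eqP; rewrite -subr_eq0 -addrA -mulrBr -rmorphB.
  by apply/negP; rewrite eps_perturb_neq0 ?oner_neq0.
by have [c ->] := xC k; rewrite !mevalC.
Qed.

Lemma HC_border_proj_scaledHC n : border_proj (HC F n) (fpoly (scaledHC F) n).
Proof.
pose e : {mpoly {poly F}[n * n]} := 'X%:MP.
(* The error is found over F[eps], before passing to fractions, as a border projection demands;
   products of polynomials 1 + e g keep this form. *)
have [g gE] : exists g, (\prod_k (1 + e * 'X_k)) ^+ 2 = 1 + e * g.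
  suff [g ->] : exists g, \prod_k (1 + e * 'X_k) = 1 + e * g.
    by exists (g *+ 2 + e * g ^+ 2); ring.
  apply: (big_ind (fun p => exists g, p = 1 + e * g)) => [|p q [g ->] [g' ->]|k _].
  - by exists 0; rewrite mulr0 addr0.
  - by exists (g + g' + e * g * g'); ring.
  - by exists 'X_k.
have HCF : liftF (HC F n) = HC (Feps F) n.
  rewrite !HCE hc_map; congr hc; apply/matrixP => i j; rewrite !mxE; exact: liftFX.
have HCP : liftE (HC {poly F} n) = HC (Feps F) n.
  rewrite !HCE hc_map; congr hc; apply/matrixP => i j; rewrite !mxE; exact: liftEX.
pose a (i : 'I_2) : Feps F := if i == ord0 then (eps F)^-1 else eps F ^+ (n * n).
exists (HC _ n * g), [tuple match split i with inl k => 'X_k | inr j => (a j)%:MP end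
                     | i < n * n + 2]; split=> [i|].
  by rewrite tnth_mktuple; case: (split i) => j; [apply: simpleX|apply: simpleC].
rewrite !padded_map /= !liftFX !comp_mpolyXU -!tnth_nth !tnth_mktuple.
rewrite !(unsplitK (inr _)) (@eq_padded _ _ _ (fun k => 'X_k)) => [|k]; last first.
  by rewrite /= liftFX comp_mpolyXU -tnth_nth tnth_mktuple (unsplitK (inl k)).
rewrite /padded -HCE HCF -HCP.
have -> : (eps F)%:MP = liftE e by rewrite liftEC.
transitivity (liftE (HC {poly F} n * (1 + e * g))).
  by rewrite mulrDr mulr1 mulrCA liftED !(liftEM e).
rewrite -gE liftEM; congr (_ * _); rewrite rmorphXn; congr (_ ^+ 2); rewrite rmorph_prod /a /=.
(* Each of the n^2 factors 1/eps + x_k receives one eps and becomes 1 + eps x_k. *)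
have -> : (eps F ^+ (n * n))%:MP_[n * n] = \prod_(k < n * n) (eps F)%:MP.
  by rewrite prodr_const card_ord rmorphXn.
rewrite -big_split; apply: eq_bigr => k _ /=.
rewrite rmorphD rmorph1 rmorphM /= liftEX liftEC mulrDr -mpolyCM mulfV ?eps_neq0 //.
Qed.
End BorderProjection.

(** * Costs of oracle circuits *)

Section CircuitCost.
Variables (K : comNzRingType) (N M : nat) (g : {mpoly K[M]}).
Implicit Types (f : {mpoly K[N]}) (vs ws : seq {mpoly K[N]}) (C : seq (gate K N)).

Lemma circ_vals_rcons C a :
  circ_vals g (rcons C a) = rcons (circ_vals g C) (gate_val g (circ_vals g C) a).
Proof. by rewrite /circ_vals foldl_rcons. Qed.

Lemma size_circ_vals C : size (circ_vals g C) = size C.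
Proof. by elim/last_ind: C => // C a IH; rewrite circ_vals_rcons !size_rcons IH. Qed.

Lemma circ_wf_rcons C a :
  circ_wf M (rcons C a) = circ_wf M C && gate_wf M (size C) a.
Proof.
rewrite /circ_wf size_rcons -addn1 iotaD all_cat /= add0n andbT.
rewrite nth_rcons ltnn eqxx; congr (_ && _); apply: eq_in_all => p.
by rewrite mem_iota add0n => /andP[_ pC]; rewrite nth_rcons pC.
Qed.

(** The value lists of well-formed circuits. Passing from gates to values lets a computed result be
    found by membership. *)
Definition slp vs := exists2 C, circ_wf M C & circ_vals g C = vs.

Lemma slp_rcons vs a :
  slp vs -> gate_wf M (size vs) a -> slp (rcons vs (gate_val g vs a)).
Proof.
move=> [C Cw <-]; rewrite size_circ_vals => aw; exists (rcons C a).
  by rewrite circ_wf_rcons Cw.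
by rewrite circ_vals_rcons.
Qed.

(* Cost in the presence of arbitrary earlier values, so that costs add up. *)
Definition cost f s := forall vs, slp vs ->
  exists ws, [/\ (size ws <= s)%N, slp (vs ++ ws) & f \in vs ++ ws].

Lemma cost_le s f s' : (s <= s')%N -> cost f s -> cost f s'.
Proof.
by move=> ss fs vs /fs[ws [? ? ?]]; exists ws; split=> //; apply: leq_trans ss.
Qed.

Lemma cost_simple f : simple f -> cost f 1.
Proof.
move=> fS vs vsP; exists [:: f]; rewrite cats1 mem_rcons mem_head; split=> //.
by case: fS => [[i ->]|[c ->]]; [apply: (slp_rcons (a := GVar K i))|apply: (slp_rcons (a := GConst N c))].
Qed.

Lemma cost_all (Fs : seq {mpoly K[N]}) s : (forall f, f \in Fs -> cost f s) ->
  forall vs, slp vs -> exists ws,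
    [/\ (size ws <= s * size Fs)%N, slp (vs ++ ws) & {subset Fs <= vs ++ ws}].
Proof.
elim: Fs => [|f Fs IH] Fss vs vsP.
  by exists [::]; rewrite cats0; split.
have [ws [ws_s wsP fw]] := Fss f (mem_head _ _) vs vsP.
have [|us [us_s usP Fu]] := IH _ (vs ++ ws) wsP.
  by move=> h hF; apply: Fss; rewrite inE hF orbT.
exists (ws ++ us); rewrite catA; split=> //.
  by rewrite size_cat mulnS leq_add.
by move=> h; rewrite inE => /predU1P[->|/Fu//]; rewrite mem_cat fw.
Qed.

Lemma cost_gate2 (op : {mpoly K[N]} -> {mpoly K[N]} -> {mpoly K[N]})
    (G : nat -> nat -> gate K N) f f' s s' :
  (forall p i j, gate_wf M p (G i j) = (i < p)%N && (j < p)%N) ->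
  (forall vs i j, gate_val g vs (G i j) = op (nth 0 vs i) (nth 0 vs j)) ->
  cost f s -> cost f' s' -> cost (op f f') (s + s').+1.
Proof.
move=> Gw Gv fs fs' vs /fs[ws [ws_s wsP fw]].
have [us [us_s usP fu]] := fs' _ wsP.
have fwu : f \in (vs ++ ws) ++ us by rewrite mem_cat fw.
exists (rcons (ws ++ us) (op f f')); rewrite -rcons_cat catA.
rewrite size_rcons size_cat ltnS leq_add // mem_rcons mem_head; split=> //.
have := slp_rcons (a := G (index f ((vs ++ ws) ++ us)) (index f' ((vs ++ ws) ++ us))) usP.
by rewrite Gw Gv !index_mem !nth_index // fwu fu; apply.
Qed.

Lemma costD f f' s s' : cost f s -> cost f' s' -> cost (f + f') (s + s').+1.
Proof. exact: (@cost_gate2 +%R (@GAdd K N)). Qed.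

Lemma costM f f' s s' : cost f s -> cost f' s' -> cost (f * f') (s + s').+1.
Proof. exact: (@cost_gate2 *%R (@GMul K N)). Qed.

Lemma cost_oracle (lq : M.-tuple {mpoly K[N]}) s :
  (forall i, cost (tnth lq i) s) -> cost (g \mPo lq) (s * M).+1.
Proof.
move=> lqs vs vsP.
have [|ws [ws_s wsP lqw]] := @cost_all lq s _ vs vsP.
  by move=> f /tnthP[i ->].
rewrite size_tuple in ws_s.
exists (rcons ws (g \mPo lq)); rewrite -rcons_cat size_rcons ltnS ws_s.
rewrite mem_rcons mem_head; split=> //.
have := slp_rcons (a := GOrc K N [seq index f (vs ++ ws) | f <- lq]) wsP.
rewrite /= size_map size_tuple eqxx all_map /= => H.
have -> : lq = [tuple nth 0 (vs ++ ws)
    (nth 0%N [seq index f (vs ++ ws) | f <- lq] k) | k < M].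
  apply: eq_from_tnth => k; rewrite tnth_mktuple (nth_map 0) ?size_tuple //.
  by rewrite -tnth_nth nth_index // lqw // mem_tnth.
by apply: H; apply/allP => f /lqw fw; rewrite /= index_mem.
Qed.

Lemma cost_sum I (r : seq I) (F : I -> {mpoly K[N]}) s :
  (forall i, cost (F i) s) -> cost (\sum_(i <- r) F i) (s.+1 * size r).+1.
Proof.
move=> Fs; elim: r => [|i r IH]; first by rewrite big_nil muln0; apply: cost_simple.
rewrite big_cons; apply: cost_le (costD (Fs i) IH).
by rewrite /= mulnS; lia.
Qed.

Lemma cost_oracle_cplx f s : cost f s -> oracle_cplx_le g f s.+2.
Proof.
have slp0 : slp [::] by exists [::].
move=> /(_ _ slp0)[ws /= [ws_s wsP fw]].
(* The output has to be the last node, so [f] is repeated at the end as f + 0; this accounts for the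
   two extra gates. *)
have wsP0 := slp_rcons (a := GConst N 0) wsP isT.
have [|C Cw CE] := slp_rcons (a := GAdd K N (index f ws) (size ws)) wsP0.
  by rewrite /= size_rcons !ltnS leqnn index_size.
have sC : size C = (size ws).+2 by rewrite -size_circ_vals CE !size_rcons.
exists C; split=> //; split; first by rewrite sC.
split; first by move=> C0; rewrite C0 in sC.
rewrite CE last_rcons /= !nth_rcons ltnn eqxx index_mem fw nth_index //.
by rewrite mpolyC0 addr0.
Qed.

(** [M] leaves, one oracle gate, and the two output gates of [cost_oracle_cplx]. *)
Lemma oracle_cplx_proj f : is_proj f g -> oracle_cplx_le g f M.+3.
Proof.
move=> [lq [lqS ->]]; apply: cost_oracle_cplx.
by apply: cost_le (cost_oracle (s := 1) _); [rewrite mul1n|move=> i; apply: cost_simple].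
Qed.

End CircuitCost.

(** * Extension of the base field of a circuit *)

Section LiftCircuit.
Variables (K L : fieldType) (phi : {rmorphism K -> L}).

Definition gate_map N (a : gate K N) : gate L N :=
  match a with
  | GVar i => GVar L i
  | GConst c => GConst N (phi c)
  | GAdd i j => GAdd L N i j
  | GMul i j => GMul L N i j
  | GOrc s => GOrc L N s
  end.

Lemma nth_map_mpoly N (vs : seq {mpoly K[N]}) i :
  nth 0 (map (map_mpoly phi) vs) i = map_mpoly phi (nth 0 vs i).
Proof.
have [lt_i|le_i] := ltnP i (size vs); first by rewrite (nth_map 0).
by rewrite !nth_default ?size_map // raddf0.
Qed.

Lemma gate_val_map N M (g : {mpoly K[M]}) vs (a : gate K N) :
  gate_val (map_mpoly phi g) (map (map_mpoly phi) vs) (gate_map a) =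
  map_mpoly phi (gate_val g vs a).
Proof.
case: a => [i|c|i j|i j|s] /=; rewrite ?nth_map_mpoly.
- by rewrite map_mpolyX.
- by rewrite map_mpolyC.
- by rewrite rmorphD.
- by rewrite rmorphM.
rewrite (map_mpoly_comp _ _ (fmorph_inj phi)); congr (_ \mPo _).
apply: eq_from_tnth => k.
by rewrite tnth_mktuple nth_map_mpoly tnth_map tnth_mktuple.
Qed.

(** Applying [phi] to the constants keeps the shape of the circuit and maps the value of every node
    by [phi]. *)
Lemma oracle_cplx_map N M (g : {mpoly K[M]}) (f : {mpoly K[N]}) c :
  oracle_cplx_le g f c ->
  oracle_cplx_le (map_mpoly phi g) (map_mpoly phi f) c.
Proof.
case=> C [Cw [Cc [C0 Cf]]]; exists (map (@gate_map N) C); split.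
  rewrite /circ_wf size_map; apply/allP => p /[dup] pC /(allP Cw).
  rewrite (nth_map (GConst N 0)); first by case: nth.
  by move: pC; rewrite mem_iota.
rewrite size_map; split=> //; split; first by case: (C) C0.
rewrite -Cf; transitivity (last 0 (map (map_mpoly phi) (circ_vals g C))); last first.
  by rewrite -!nth_last nth_map_mpoly size_map.
congr (last 0 _); elim/last_ind: C {Cw Cc C0 Cf} => // C a IH.
by rewrite map_rcons !circ_vals_rcons IH gate_val_map map_rcons.
Qed.

End LiftCircuit.

(** * Computing HC from the padded family by interpolation *)

Section Interpolation.
Variable F : fieldType.
Hypothesis F0 : forall n, (n.+1%:R : F) != 0.

Lemma natr_inj : injective (fun n => n%:R : F).
Proof.
move=> m n; wlog le_mn : m n / (m <= n)%N.
  by move=> H; case/orP: (leq_total m n) => [/H//|/H h /esym/h].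
move=> /eqP; rewrite eq_sym -subr_eq0 -natrB // => /eqP nm.
apply/eqP; rewrite eqn_leq le_mn -subn_eq0.
by move: nm; case: (n - m)%N => // d /eqP; rewrite (negbTE (F0 d)).
Qed.

(** The weights form column [n] of the inverse Vandermonde matrix at the nodes 0, ..., D, which are
    distinct by [natr_inj]. They do not depend on [P]. *)
Lemma coef_interpolation D n : (n <= D)%N ->
  exists l : 'I_D.+1 -> F, forall N (P : {poly {mpoly F[N]}}), (size P <= D.+1)%N ->
    P`_n = \sum_k (l k)%:MP * P.[(k%:R)%:MP].
Proof.
move=> nD; pose V := Vandermonde D.+1 (\row_(k < D.+1) (k%:R : F)).
have Vu : V \in unitmx.
  rewrite unitmxE det_Vandermonde unitfE; apply/prodf_neq0 => i _.
  apply/prodf_neq0 => j ij; rewrite !mxE subr_eq0.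
  by apply/eqP => /natr_inj ji; rewrite ji ltnn in ij.
pose l := invmx V *m delta_mx (Ordinal (nD : n < D.+1)%N) (ord0 : 'I_1).
exists (fun k => l k ord0) => N P sP.
have lE (i : 'I_D.+1) : \sum_k l k ord0 * k%:R ^+ i = (i == n :> nat)%:R.
  have := congr1 (fun A : 'M_(_, _) => A i ord0) (mulKVmx Vu (delta_mx (Ordinal (nD : n < D.+1)%N) (ord0 : 'I_1))).
  rewrite -/l !mxE eqxx andbT => <-; apply: eq_bigr => k _.
  by rewrite !mxE mulrC.
under eq_bigr do rewrite (horner_coef_wide _ sP) mulr_sumr.
rewrite exchange_big /=.
transitivity (\sum_(i < D.+1) P`_i * (i == n :> nat)%:R).
  rewrite (bigD1 (Ordinal (nD : n < D.+1)%N)) //= eqxx mulr1 big1 ?addr0 // => i.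
  by rewrite -val_eqE /= => /negbTE->; rewrite mulr0.
apply: eq_bigr => i _; rewrite -mpolyC_nat -lE rmorph_sum mulr_sumr.
apply: eq_bigr => k _.
by rewrite /= mpolyCM rmorphXn mulrCA.
Qed.

Lemma size_polyM_leS (R : comNzRingType) (p q : {poly R}) a b :
  (size p <= a.+1 -> size q <= b.+1 -> size (p * q)%R <= (a + b).+1)%N.
Proof.
by move=> pa qb; apply: leq_trans (size_polyMleq _ _) _; move: pa qb; lia.
Qed.

Lemma HC_c_red_padHC : c_red (HCfam F) (padHC F).
Proof.
exists id; split; first exact: polybounded_id.
(* A bound on the degree in t of A_n(t x): [n] from HC_n and n^2 from each of the two copies of the
   product. *)
pose D n := (n + (n * n + n * n))%N.
(* Each of the D + 1 terms takes 3 gates for each of the n^2 inputs t x_k, then the oracle gate, the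
   weight and their product; one addition per term, the initial 0 and two output gates are added. *)
exists (fun n => ((3 * (n * n) + 3).+1 * (D n).+1).+3)%N; split.
  have sq : polybounded (fun n => n * n)%N by apply: polyboundedM polybounded_id polybounded_id.
  have DP : polybounded D.
    by apply: polyboundedD polybounded_id _; apply: polyboundedD.
  apply: (@polybounded_le (fun n => (3 * (n * n) + 4) * (D n + 1) + 3)%N) => [n|]; first by lia.
  apply: polyboundedD (polybounded_const _); apply: polyboundedM.
    apply: polyboundedD (polybounded_const _).
    exact: polyboundedM (polybounded_const _) sq.
  exact: polyboundedD DP (polybounded_const _).
move=> n; have nD : (n <= D n)%N by rewrite leq_addr.
have [l lP] := coef_interpolation nD.
pose T := {mpoly F[n * n]}.
pose P : {poly T} := padded (fun k => 'X * ('X_k)%:P) 1 1.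
have PE : P = 'X^n * ((HC F n)%:P * (\prod_k (1 + 'X * ('X_k)%:P)) ^+ 2).
  rewrite mulrA /P /padded mul1r HCE hc_map -hcZ; congr (hc _ * _).
  by apply/matrixP => i j; rewrite !mxE.
have sP : (size P <= (D n).+1)%N.
  have sQ : (size (\prod_k (1 + 'X * ('X_k : T)%:P))%R <= (n * n).+1)%N.
    rewrite -[in leqRHS](size_index_ord (n * n)); elim: index_enum => [|k r IH].
      by rewrite big_nil size_poly1.
    rewrite big_cons /=; apply: (@size_polyM_leS _ _ _ 1) => //.
    apply: leq_trans (size_polyD _ _) _; rewrite geq_max size_poly1 /=.
    by apply: (@size_polyM_leS _ _ _ 1 0); rewrite ?size_polyX ?size_polyC_leq1.
  rewrite PE; apply: size_polyM_leS; first by rewrite size_polyXn.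
  by apply: (@size_polyM_leS _ _ _ 0); rewrite ?size_polyC_leq1 // expr2 size_polyM_leS.
(* After division by t^n, every padding factor 1 + t x_k becomes 1 at t = 0. *)
have Pn : P`_n = HC F n.
  rewrite PE coefXnM ltnn subnn -horner_coef0 hornerM hornerC horner_exp horner_prod.
  rewrite big1 ?expr1n ?mulr1 // => k _.
  by rewrite hornerD hornerM hornerX mul0r hornerC addr0.
(* Evaluation at t = c is a single oracle call on the inputs c x_k. *)
have Pt (c : T) : P.[c] = fpoly (padHC F) n \mPo [tuple c * 'X_k | k < n * n].
  rewrite -[LHS]/(horner_eval c P) !padded_map !rmorph1; apply: eq_padded => k.
  by rewrite /= /horner_eval hornerM hornerX hornerC comp_mpolyXU -tnth_nth tnth_mktuple.
apply: cost_oracle_cplx; rewrite -[fpoly (HCfam F) n]Pn (lP _ _ sP).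
have := @cost_sum F (n * n) (n * n) (fpoly (padHC F) n) _ (index_enum 'I_(D n).+1)
  (fun k => (l k)%:MP * P.[(k%:R)%:MP]) (3 * (n * n) + 3).
rewrite size_index_ord; apply=> k; rewrite Pt.
apply: (@cost_le _ _ _ _ (1 + (3 * (n * n)).+1).+1); first by lia.
apply: costM; first exact: cost_simple.
apply: cost_oracle => i; rewrite tnth_mktuple.
by apply: (@costM _ _ _ _ _ _ 1 1); apply: cost_simple.
Qed.

End Interpolation.

(** * Comparison of the reductions, and the separations *)

Lemma is_proj_map (K L : fieldType) (phi : {rmorphism K -> L}) N M
    (f : {mpoly K[N]}) (g : {mpoly K[M]}) :
  is_proj f g -> is_proj (map_mpoly phi f) (map_mpoly phi g).
Proof.
case=> lq [lqS ->]; exists (map_tuple (map_mpoly phi) lq); split=> [i|].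
  rewrite tnth_map; case: (lqS i) => [[j ->]|[c ->]].
    by rewrite map_mpolyX; apply: simpleX.
  by rewrite map_mpolyC; apply: simpleC.
exact: map_mpoly_comp (fmorph_inj phi).
Qed.

Section Reductions.
Variable F : fieldType.
Implicit Types f g : pfam F.

Lemma liftF_eps0 N (p : {mpoly F[N]}) : liftF p + (eps F)%:MP * liftE 0 = liftF p.
Proof. by rewrite liftEE raddf0 mulr0 addr0. Qed.

Lemma p_red_bp_red f g : p_red f g -> bp_red f g.
Proof.
case=> t [tb tP]; exists t; split=> // n; exists 0; rewrite liftF_eps0.
exact: (is_proj_map (@eps_const F)).
Qed.

Lemma c_red_bc_red f g : c_red f g -> bc_red f g.
Proof.
case=> t [tb [b [bb bP]]]; exists t; split=> //; exists b; split=> // n.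
by exists 0; rewrite liftF_eps0; apply: (oracle_cplx_map (@eps_const F)).
Qed.

(** Simulating a projection by a circuit takes a leaf for each input of the oracle gate; for a
    p-family this number stays polynomially bounded. *)
Lemma polybounded_arity g t :
  is_pfamily g -> polybounded t -> polybounded (fun n => nvars g (t n) + 3)%N.
Proof.
move=> [nb _] tb; apply: polyboundedD (polybounded_const _).
exact: polybounded_comp.
Qed.

Lemma p_red_c_red f g : is_pfamily g -> p_red f g -> c_red f g.
Proof.
move=> gP [t [tb tP]]; exists t; split=> //.
exists (fun n => nvars g (t n) + 3)%N; split=> [|n]; first exact: polybounded_arity.
by rewrite addn3; apply: oracle_cplx_proj.
Qed.

Lemma bp_red_bc_red f g : is_pfamily g -> bp_red f g -> bc_red f g.
Proof.
move=> gP [t [tb tP]]; exists t; split=> //.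
exists (fun n => nvars g (t n) + 3)%N; split=> [|n]; first exact: polybounded_arity.
have [h hP] := tP n; exists h.
by rewrite addn3; apply: oracle_cplx_proj.
Qed.

Lemma theorem2_pchar0 : (forall n, (n.+1%:R : F) != 0) -> theorem2_claim F.
Proof.
move=> F0; have p_bp := p_red_bp_red; have c_bc := c_red_bc_red.
have cA : VNPC (@c_red F) (padHC F).
  by split; [apply: VNP_padHC|apply: HC_c_red_padHC].
have bpA : ~ bp_red (HCfam F) (padHC F).
  (* The single member HC_1 = x rules out the reduction, whatever the index t(1) is. *)
  by case=> t [_ /(_ 1%N)]; apply: HC1_not_border_proj_padHC.
split; [| | | |split].
- by move=> f [fV fr]; split=> //; apply: p_red_c_red fr; case: fV.
- by move=> f [fV fr]; split=> //; apply: c_bc.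
- by move=> f [fV fr]; split=> //; apply: p_bp.
- by move=> f [fV fr]; split=> //; apply: bp_red_bc_red fr; case: fV.
(* [padHC] is the witness here and in the last two separations: a projection is also a border
   projection, so [bpA] excludes both. *)
- by move=> /(_ _ cA)[_ /p_bp].
- move=> H; have [] := H (scaledHC F).
    split; first exact: VNP_scaledHC.
    by exists id; split=> [|n]; [apply: polybounded_id|apply: HC_border_proj_scaledHC].
  by move=> _ [t [_ /(_ 1%N)]]; apply: HC1_not_proj_scaledHC; apply: F0.
- by move=> /(_ _ cA)[].
- by case: cA => AV /c_bc Ar /(_ _ (conj AV Ar))[].
Qed.
End Reductions.

(* F in {Q, R, C} *)
Theorem theorem2 : theorem2_claim rat /\ theorem2_claim RR /\ theorem2_claim CC.
Proof.
split; [|split]; apply: theorem2_pchar0 => n.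
- by rewrite Num.Theory.pnatr_eq0.
- apply: negbT; exact: (Num.Theory.pnatr_eq0 (Rdefinitions.R : numFieldType)).
- apply: negbT; exact: (Num.Theory.pnatr_eq0 (complex Rdefinitions.R : numFieldType)).
Qed.
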